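(* Any non-trivial 2-dimensional real division algebra is isomorphic to one and only one of the following division algebras, listed by their matrices of structure constants (different parameter values count as different members of the list; all parameters are real): \[A_{1,r}(\alpha_1,\alpha_2,\alpha_4,\beta_1)=\begin{pmatrix}\alpha_1&\alpha_2&\alpha_2+1&\alpha_4\\ \beta_1&-\alpha_1&-\alpha_1+1&-\alpha_2\end{pmatrix},\ \text{for which}\ \Delta_m^2-4\Delta_l\Delta_r<0,\] \[A_{2,r}(\alpha_1,\beta_1,\beta_2)=\begin{pmatrix}\alpha_1&0&0&1\\ \beta_1&\beta_2&1-\alpha_1&0\end{pmatrix},\ \beta_1\ge0,\ \text{for which}\ \beta_1^2+4\alpha_1(1-\alpha_1)\beta_2<0,\] \[A_{3,r}(\alpha_1,\beta_1,\beta_2)=\begin{pmatrix}\alpha_1&0&0&-1\\ \beta_1&\beta_2&1-\alpha_1&0\end{pmatrix},\ \beta_1\ge0,\ \text{for which}\ \beta_1^2-4\alpha_1(1-\alpha_1)\beta_2<0,\] \[A_{4,r}(\beta_1,\beta_2)=\begin{pmatrix}0&1&1&0\\ \beta_1&\beta_2&1&-1\end{pmatrix},\ \text{for which}\ (1-\beta_2)^2-4\beta_1<0,\] \[A_{7,r}(\alpha_1,\beta_1)=\begin{pmatrix}\alpha_1&0&0&1\\ \beta_1&1-\alpha_1&-\alpha_1&0\end{pmatrix},\ \beta_1\ge0,\ \text{for which}\ \beta_1^2-4\alpha_1^2(1-\alpha_1)<0,\] \[A_{8,r}(\alpha_1,\beta_1)=\begin{pmatrix}\alpha_1&0&0&-1\\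 \beta_1&1-\alpha_1&-\alpha_1&0\end{pmatrix},\ \beta_1\ge0,\ \text{for which}\ \beta_1^2+4\alpha_1^2(1-\alpha_1)<0,\] \[A_{9,r}(\beta_1)=\begin{pmatrix}0&1&1&0\\ \beta_1&1&0&-1\end{pmatrix},\ \text{for which}\ 1-4\beta_1<0,\] \[A_{12,r}=\begin{pmatrix}0&1&1&0\\ 1&0&0&-1\end{pmatrix}.\]
   Context: A 2-dimensional real algebra is a 2-dimensional real vector space $\mathbb{A}$ with a bilinear multiplication $\cdot$ (not necessarily associative, commutative or unital); it is non-trivial if the multiplication is not identically zero. It is a division algebra if $\mathbf{u}\cdot\mathbf{v}=0$ holds if and only if at least one of $\mathbf{u},\mathbf{v}$ is zero. Given a basis $(e_1,e_2)$, the matrix of structure constants (MSC) of $\mathbb{A}$ is \[A=\begin{pmatrix}A^1_{1,1}&A^1_{1,2}&A^1_{2,1}&A^1_{2,2}\\ A^2_{1,1}&A^2_{1,2}&A^2_{2,1}&A^2_{2,2}\end{pmatrix},\qquad e_i\cdot e_j=A^1_{i,j}e_1+A^2_{i,j}e_2.\] Two algebras with MSCs $A$ and $B$ are isomorphic if and only if $B=gA(g^{-1}\otimes g^{-1})$ for some $g\in GL(2,\mathbb{R})$, where $\otimes$ is the Kronecker product. An algebra is identified with its MSC. For a general MSC $\begin{pmatrix}a_1&a_2&a_3&a_4\\ b_1&b_2&b_3&b_4\end{pmatrix}$ one sets \[\Delta_l=a_1b_3-a_3b_1,\qquad \Delta_m=(a_1b_4-a_4b_1)+(a_2b_3-a_3b_2),\qquad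 \Delta_r=a_2b_4-a_4b_2.\] In particular, for $A_{1,r}(\alpha_1,\alpha_2,\alpha_4,\beta_1)$ these are $\Delta_l=\alpha_1(1-\alpha_1)-\beta_1(\alpha_2+1)$, $\Delta_m=-\alpha_1\alpha_2-\alpha_4\beta_1+\alpha_1+\alpha_2$, $\Delta_r=-\alpha_2^2+\alpha_1\alpha_4$. *)

(* Defs.v *)
From HB Require Import structures.
From mathcomp Require Import all_boot all_order all_algebra.
From mathcomp Require Import reals.

Set Implicit Arguments.
Unset Strict Implicit.
Unset Printing Implicit Defensive.

Import Order.TTheory GRing.Theory Num.Theory.
Local Open Scope ring_scope.

(* An algebra (not necessarily associative, commutative or unital) is given   *)
(* by its multiplication on an R-module.                                      *)

Section Algebras.
Variable R : realType.

Definition nontrivial (V : lmodType R) (mul : V -> V -> V) : Prop :=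
  exists u v : V, mul u v != 0.

Definition division (V : lmodType R) (mul : V -> V -> V) : Prop :=
  forall u v : V, mul u v = 0 <-> u = 0 \/ v = 0.

Definition isomorphic (V W : lmodType R)
    (mulV : V -> V -> V) (mulW : W -> W -> W) : Prop :=
  exists f : {linear V -> W},
    bijective f /\ {morph f : u v / mulV u v >-> mulW u v}.

End Algebras.

Section StructureConstants.
Variable R : realType.

(* The columns of an MSC are indexed by the pairs (1,1), (1,2), (2,1), (2,2), *)
(* in this order.                                                             *)
Definition msc (a1 a2 a3 a4 b1 b2 b3 b4 : R) : 'M[R]_(2, 4) :=
  \matrix_(k < 2, j < 4)
    nth 0 (if k == 0 then [:: a1; a2; a3; a4] else [:: b1; b2; b3; b4]) j.

(* mxvec (u *m v^T) is the (transposed) Kronecker product of the coordinate   *)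
(* columns u and v, so that msc_mul A u v = A (u (x) v).                      *)
Definition msc_mul (A : 'M[R]_(2, 4)) (u v : 'cV[R]_2) : 'cV[R]_2 :=
  A *m (mxvec (u *m v^T))^T.

Lemma msc_mul_bilinear (A : 'M[R]_(2, 4)) :
  bilinear_for *:%R *:%R (msc_mul A).
Proof.
split=> w c u v; rewrite /msc_mul /=.
  by rewrite mulmxDl -scalemxAl !linearP.
by rewrite linearP /= mulmxDr -scalemxAr !linearP.
Qed.

HB.instance Definition _ (A : 'M[R]_(2, 4)) :=
  bilinear_isBilinear.Build R 'cV[R]_2 'cV[R]_2 'cV[R]_2 *:%R *:%R
    (msc_mul A) (msc_mul_bilinear A).

Lemma mxvec_index22 (i j : 'I_2) :
  nat_of_ord (mxvec_index i j) = (2 * i + j)%N.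
Proof.
have ltij : (2 * i + j < size (enum {: 'I_2 * 'I_2}))%N.
  rewrite -cardE card_prod card_ord.
  by case: i j => [[|[|?]] ?] [[|[|?]] ?].
rewrite /= -[RHS](index_uniq (i, j) ltij (enum_uniq _)).
rewrite /enum_rank enum_rank_in.unlock insubdK; last first.
  by rewrite unfold_in cardE index_mem mem_enum.
congr (index _ _); rewrite enumT unlock /= /prod_enum !enum_ordSl /=.
rewrite (size0nil (size_enum_ord 0)) /=.
by case: i j {ltij} => [[|[|?]] ?] [[|[|?]] ?] //=;
  congr (_, _); apply: val_inj.
Qed.

(* e_i . e_j = A^1_(i,j) e_1 + A^2_(i,j) e_2                                  *)
Lemma msc_mul_basis (A : 'M[R]_(2, 4)) (i j : 'I_2) :
  msc_mul A (delta_mx i 0) (delta_mx j 0)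
  = \sum_(k < 2) A k (inord (2 * i + j)%N) *: delta_mx k 0.
Proof.
apply/colP=> l; rewrite summxE (bigD1 l) //= !mxE eqxx mulr1.
rewrite [X in _ + X]big1 ?addr0; last first.
  by move=> k /negPf neq_kl; rewrite !mxE eq_sym neq_kl mulr0.
have -> : inord (2 * i + j)%N = mxvec_index i j :> 'I_4.
  apply: val_inj; rewrite [RHS]mxvec_index22 /= inordK //.
  by case: i j => [[|[|?]] ?] [[|[|?]] ?].
rewrite (bigD1 (mxvec_index i j)) //= mxE mxvecE
  trmx_delta mul_delta_mx mxE !eqxx mulr1.
rewrite big1 ?addr0 // => k; rewrite mxE; case/mxvec_indexP: k => i' j' neq.
rewrite mxvecE mxE; case: (eqVneq i' i) => [eq_i|]; rewrite ?mulr0 //.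
case: (eqVneq j' j) => [eq_j|]; rewrite ?mulr0 //.
by rewrite eq_i eq_j eqxx in neq.
Qed.

(* Columns are numbered from 0 here.                                          *)
Definition minor (A : 'M[R]_(2, 4)) (j k : 'I_4) : R :=
  A 0 j * A 1 k - A 0 k * A 1 j.

Definition Delta_l (A : 'M[R]_(2, 4)) : R := minor A 0 2.
Definition Delta_m (A : 'M[R]_(2, 4)) : R := minor A 0 3 + minor A 1 2.
Definition Delta_r (A : 'M[R]_(2, 4)) : R := minor A 1 3.

Lemma DeltaE (a1 a2 a3 a4 b1 b2 b3 b4 : R) :
  let A := msc a1 a2 a3 a4 b1 b2 b3 b4 in
  [/\ Delta_l A = a1 * b3 - a3 * b1,
      Delta_m A = (a1 * b4 - a4 * b1) + (a2 * b3 - a3 * b2)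
    & Delta_r A = a2 * b4 - a4 * b2].
Proof. by rewrite /Delta_l /Delta_m /Delta_r /minor /= !mxE. Qed.

End StructureConstants.

(* The list of normal forms: a member is a family together with the values of *)
(* its parameters, subject to the constraints in [admissible].                *)
Inductive normal_form (R : realType) : Type :=
| A1 (alpha1 alpha2 alpha4 beta1 : R)
| A2 (alpha1 beta1 beta2 : R)
| A3 (alpha1 beta1 beta2 : R)
| A4 (beta1 beta2 : R)
| A7 (alpha1 beta1 : R)
| A8 (alpha1 beta1 : R)
| A9 (beta1 : R)
| A12.
Arguments A12 {R}.

Section NormalForms.
Variable R : realType.

Definition msc_of (c : normal_form R) : 'M[R]_(2, 4) :=
  match c with
  | A1 alpha1 alpha2 alpha4 beta1 =>
      msc alpha1   alpha2   (alpha2 + 1)   alpha4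
          beta1  (- alpha1) (- alpha1 + 1) (- alpha2)
  | A2 alpha1 beta1 beta2 =>
      msc alpha1   0        0              1
          beta1    beta2    (1 - alpha1)   0
  | A3 alpha1 beta1 beta2 =>
      msc alpha1   0        0              (- 1)
          beta1    beta2    (1 - alpha1)   0
  | A4 beta1 beta2 =>
      msc 0        1        1              0
          beta1    beta2    1              (- 1)
  | A7 alpha1 beta1 =>
      msc alpha1   0            0          1
          beta1    (1 - alpha1) (- alpha1) 0
  | A8 alpha1 beta1 =>
      msc alpha1   0            0          (- 1)
          beta1    (1 - alpha1) (- alpha1) 0
  | A9 beta1 =>
      msc 0        1        1              0
          beta1    1        0              (- 1)
  | A12 =>
      msc 0        1        1              0
          1        0        0              (- 1)
  end.

Definition admissible (c : normal_form R) : Prop :=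
  match c with
  | A1 _ _ _ _ =>
      let A := msc_of c in Delta_m A ^+ 2 - 4 * Delta_l A * Delta_r A < 0
  | A2 alpha1 beta1 beta2 =>
      0 <= beta1 /\ beta1 ^+ 2 + 4 * alpha1 * (1 - alpha1) * beta2 < 0
  | A3 alpha1 beta1 beta2 =>
      0 <= beta1 /\ beta1 ^+ 2 - 4 * alpha1 * (1 - alpha1) * beta2 < 0
  | A4 beta1 beta2 => (1 - beta2) ^+ 2 - 4 * beta1 < 0
  | A7 alpha1 beta1 =>
      0 <= beta1 /\ beta1 ^+ 2 - 4 * alpha1 ^+ 2 * (1 - alpha1) < 0
  | A8 alpha1 beta1 =>
      0 <= beta1 /\ beta1 ^+ 2 + 4 * alpha1 ^+ 2 * (1 - alpha1) < 0
  | A9 beta1 => 1 - 4 * beta1 < 0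
  | A12 => True
  end.

End NormalForms.

(* Main.v *)
(* Besides the division property (negative discriminant of the binary form    *)
(* det (_ . v)), the only invariants needed are the trace forms tr (u . _)    *)
(* and tr (_ . v). If they are independent, their dual basis is canonical and *)
(* gives A1. Otherwise they have a common kernel; choose e2 in it, and e1     *)
(* normalised by a nonzero one of them. If e2 . e2 is not a multiple of e2,   *)
(* take e1 to be a multiple of e2 . e2: this gives A2, A3, A7, A8, up to      *)
(* e2 |-> - e2. If it is one, scaling e2 and replacing e1 by e1 + t e2        *)
(* normalise the rest: A4, A9. If both forms vanish, the multiplication       *)
(* amounts to a binary cubic form; a real root of it gives a vector e2 with   *)
(* e2 . e2 proportional to e2, hence A12. Uniqueness is read off the          *)
(* equations of a change of basis, since the trace forms are covariant.       *)

From HB Require Import structures.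
Require Import Defs.
From mathcomp Require Import all_boot all_order all_algebra.
From mathcomp Require Import reals ring lra.
Import Order.TTheory GRing.Theory Num.Theory.
Local Open Scope ring_scope.
Set Implicit Arguments. Unset Strict Implicit. Unset Printing Implicit Defensive.

(** In a basis, the determinant of right multiplication by v is a binary quadratic form in v with
    coefficients [Delta_l], [Delta_m], [Delta_r]. The algebra is a division algebra exactly when
    this form has no nontrivial real zero, that is, when its discriminant is negative
    ([division_mscP]). Division being invariant under isomorphism, this inequality survives every
    change of basis without computation.

    It remains to normalise the basis by means of the two trace forms, which are covariant
    ([trace_basis_change]). Independent forms determine the basis ([normal_form_indep]). Dependent
    forms that are not both zero leave a triangular freedom, spent on the product e2 . e2 or e1 . e1
    ([reduce_a4_neq0], [reduce_a4_eq0], [normal_form_dep]). If both vanish, a real root of a cubic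
    supplies e2 ([traceless_a4_eq0]).

    For uniqueness ([basis_change_msc_of_inj]), a basis change between two members respects the
    normalised traces and products. When the traces are not both zero it is the identity, except for
    a possible sign of e2, which beta1 >= 0 makes harmless; when both vanish there is a single
    member. *)

Section Classification.
Variable R : realType.

(** * Coordinates in dimension two *)

Lemma ord2_cases (P : 'I_2 -> Prop) : P 0 -> P 1 -> forall i, P i.
Proof.
move=> P0 P1 i; case: (eqVneq i 0) => [-> // | i0].
by have -> : i = 1 by apply: val_inj; case: i i0 => [[|[|?]] ?].
Qed.

Lemma cV2_eqP (u v : 'cV[R]_2) : u 0 0 = v 0 0 -> u 1 0 = v 1 0 -> u = v.
Proof. by move=> e0 e1; apply/colP; apply: ord2_cases. Qed.

Lemma msc_mulE (A : 'M[R]_(2, 4)) (u v : 'cV[R]_2) (k : 'I_2) :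
  msc_mul A u v k 0 = A k 0 * (u 0 0 * v 0 0) + A k 1 * (u 0 0 * v 1 0)
                    + A k 2 * (u 1 0 * v 0 0) + A k 3 * (u 1 0 * v 1 0).
Proof.
rewrite /msc_mul mxE !big_ord_recl big_ord0 addr0 !addrA.
have E (i j : 'I_2) (l : 'I_4) : nat_of_ord l = (2 * i + j)%N ->
    (mxvec (u *m v^T))^T l 0 = u i 0 * v j 0.
  move=> el; have -> : l = mxvec_index i j.
    by apply: val_inj; rewrite [RHS]mxvec_index22.
  by rewrite mxE mxvecE mxE big_ord1 mxE.
rewrite (E 0 0) // (E 0 1) // (E 1 0) // (E 1 1) //.
by congr (A k _ * _ + A k _ * _ + A k _ * _ + A k _ * _); apply: val_inj.
Qed.

Lemma mscE (A : 'M[R]_(2, 4)) :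
  A = msc (A 0 0) (A 0 1) (A 0 2) (A 0 3) (A 1 0) (A 1 1) (A 1 2) (A 1 3).
Proof.
apply/matrixP=> k j; rewrite mxE; elim/ord2_cases: k => /=;
by case: j => [[|[|[|[|?]]]] lt_j] //=; congr (A _ _); apply: val_inj.
Qed.

Definition vec2 (x y : R) : 'cV[R]_2 := \col_i if i == 0 then x else y.

Lemma vec2E (x y : R) : (vec2 x y 0 0 = x) * (vec2 x y 1 0 = y).
Proof. by rewrite !mxE. Qed.

Lemma vec2_eta (u : 'cV[R]_2) : u = vec2 (u 0 0) (u 1 0).
Proof. by apply: cV2_eqP; rewrite vec2E. Qed.

(** * Isomorphism as an equivalence relation *)

Lemma isomorphic_refl (V : lmodType R) mV : isomorphic (V := V) (W := V) mV mV.
Proof.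
by exists (idfun : {linear V -> V}); split=> //; exists idfun.
Qed.

Lemma isomorphic_trans (U V W : lmodType R) mU mV mW :
  isomorphic (V := U) (W := V) mU mV -> isomorphic (W := W) mV mW ->
  isomorphic mU mW.
Proof.
move=> [f [bf mf]] [g [bg mg]]; exists (g \o f); split; first exact: bij_comp.
by move=> u v; rewrite /= mf mg.
Qed.

Lemma isomorphic_sym (V W : lmodType R) mV mW :
  isomorphic (V := V) (W := W) mV mW -> isomorphic mW mV.
Proof.
move=> [f [[g fK gK] mf]].
have lin_g : linear g by exact: can2_linear fK gK.
pose gL : {linear W -> V} := HB.pack g (GRing.isLinear.Build R W V *:%R g lin_g).
exists gL; split; first by exists f.
by move=> u v; rewrite /= -{1}[u]gK -{1}[v]gK -mf fK.
Qed.

Lemma division_iso (V W : lmodType R) mV mW :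
  isomorphic (V := V) (W := W) mV mW -> division mV -> division mW.
Proof.
move=> /isomorphic_sym [f [bf mf]] dV u v.
have f0 x : (f x = 0) <-> (x = 0).
  by split=> [fx|->]; [apply: (bij_inj bf); rewrite fx raddf0 | rewrite raddf0].
by rewrite -f0 mf dV !f0.
Qed.

(** * Changes of basis and covariance of the trace forms *)

Lemma bilinear_expand (V : lmodType R) (mul : {bilinear V -> V -> V})
    (a b c d : R) (w x : V) :
  mul (a *: w + b *: x) (c *: w + d *: x)
    = (a * c) *: mul w w + (a * d) *: mul w x
    + (b * c) *: mul x w + (b * d) *: mul x x.
Proof.
rewrite linearDl !linearDr !linearZl_LR !linearZr_LR !scalerA !addrA.
by congr (_ *: _ + _ *: _ + _ *: _ + _ *: _); rewrite mulrC.
Qed.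

(* [B] is the MSC of the algebra [A] in the basis [(p, q)], [(r, s)].         *)
Definition basis_change (A B : 'M[R]_(2, 4)) (p q r s : R) : Prop :=
  [/\ p * s - q * r != 0,
      msc_mul A (vec2 p q) (vec2 p q) = B 0 0 *: vec2 p q + B 1 0 *: vec2 r s,
      msc_mul A (vec2 p q) (vec2 r s) = B 0 1 *: vec2 p q + B 1 1 *: vec2 r s,
      msc_mul A (vec2 r s) (vec2 p q) = B 0 2 *: vec2 p q + B 1 2 *: vec2 r s
    & msc_mul A (vec2 r s) (vec2 r s) = B 0 3 *: vec2 p q + B 1 3 *: vec2 r s].

Lemma isomorphic_of_basis_change (A B : 'M[R]_(2, 4)) p q r s :
  basis_change A B p q r s -> isomorphic (msc_mul A) (msc_mul B).
Proof.
move=> [D0 e11 e12 e21 e22]; apply: isomorphic_sym.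
pose f (u : 'cV[R]_2) := u 0 0 *: vec2 p q + u 1 0 *: vec2 r s.
have lin_f : linear f.
  by move=> a u v; apply: cV2_eqP; rewrite !mxE /=; ring.
pose fL : {linear 'cV[R]_2 -> 'cV[R]_2} :=
  HB.pack f (GRing.isLinear.Build R _ _ *:%R f lin_f).
exists fL; split=> /=.
  exists (fun v : 'cV[R]_2 => (p * s - q * r)^-1 *:
    vec2 (v 0 0 * s - v 1 0 * r) (p * v 1 0 - q * v 0 0)).
    by move=> u; apply: cV2_eqP; rewrite !mxE /=; field.
  by move=> u; apply: cV2_eqP; rewrite !mxE /=; field.
move=> u v; rewrite /f bilinear_expand /= e11 e12 e21 e22 !msc_mulE.
by apply: cV2_eqP; rewrite !mxE /=; ring.
Qed.

(** The new basis of [A] consists of the images of the standard basis under the inverse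
    isomorphism. *)
Lemma basis_change_of_isomorphic (A B : 'M[R]_(2, 4)) :
  isomorphic (msc_mul A) (msc_mul B) ->
  exists p q r s, basis_change A B p q r s.
Proof.
move=> /isomorphic_sym [f [bf mf]].
have fE (u : 'cV[R]_2) : f u = u 0 0 *: f (vec2 1 0) + u 1 0 *: f (vec2 0 1).
  rewrite -!linearZ -linearD; congr (f _).
  by apply: cV2_eqP; rewrite !mxE /=; ring.
exists (f (vec2 1 0) 0 0), (f (vec2 1 0) 1 0).
exists (f (vec2 0 1) 0 0), (f (vec2 0 1) 1 0).
split; rewrite -?vec2_eta -?mf; last 4 first.
- by rewrite fE !msc_mulE !vec2E; congr (_ *: _ + _ *: _); ring.
- by rewrite fE !msc_mulE !vec2E; congr (_ *: _ + _ *: _); ring.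
- by rewrite fE !msc_mulE !vec2E; congr (_ *: _ + _ *: _); ring.
- by rewrite fE !msc_mulE !vec2E; congr (_ *: _ + _ *: _); ring.
(* Each [set] catches the first match left in the determinant [p * s - q * r], hence this order of
   names. *)
set p := f _ 0 0; set s := f _ 1 0; set q := f _ 1 0; set r := f _ 0 0.
have inj_f (x y : R) : x * p + y * r = 0 -> x * q + y * s = 0 -> x = 0 /\ y = 0.
  move=> e1 e2; have /(bij_inj bf) e : f (vec2 x y) = f 0.
    by rewrite raddf0 fE !vec2E; apply: cV2_eqP; rewrite !mxE; [exact: e1|exact: e2].
  by split; [rewrite -(vec2E x y).1 | rewrite -(vec2E x y).2]; rewrite e mxE.
(* If the determinant vanishes, the inverse isomorphism kills the vectors [(s, - q)] and [(- r, p)];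
   by injectivity all four entries are zero, so it also kills [(1, 0)]. *)
apply/eqP=> D0.
have [s0 q0] : s = 0 /\ - q = 0 by apply: inj_f; lra.
have [r0 p0] : - r = 0 /\ p = 0 by apply: inj_f; lra.
have [/eqP] : 1 = 0 :> R /\ 0 = 0 :> R by apply: inj_f; lra.
by rewrite oner_eq0.
Qed.

Lemma basis_change_exists (A : 'M[R]_(2, 4)) p q r s : p * s - q * r != 0 ->
  exists B, basis_change A B p q r s.
Proof.
move=> D0.
(* Coordinates in the new basis, by Cramer's rule. *)
pose c1 (w : 'cV[R]_2) := (w 0 0 * s - w 1 0 * r) / (p * s - q * r).
pose c2 (w : 'cV[R]_2) := (p * w 1 0 - q * w 0 0) / (p * s - q * r).
have cE w : w = c1 w *: vec2 p q + c2 w *: vec2 r s.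
  by apply: cV2_eqP; rewrite !mxE /= /c1 /c2; field.
pose m := msc_mul A; pose e1 := vec2 p q; pose e2 := vec2 r s.
exists (msc (c1 (m e1 e1)) (c1 (m e1 e2)) (c1 (m e2 e1)) (c1 (m e2 e2))
            (c2 (m e1 e1)) (c2 (m e1 e2)) (c2 (m e2 e1)) (c2 (m e2 e2))).
by split=> //; rewrite [LHS]cE !mxE.
Qed.

(* [trace_l A k = tr (e_k . _)] and [trace_r A k = tr (_ . e_k)]. *)
Definition trace_l (A : 'M[R]_(2, 4)) (k : 'I_2) : R :=
  if k == 0 then A 0 0 + A 1 1 else A 0 2 + A 1 3.
Definition trace_r (A : 'M[R]_(2, 4)) (k : 'I_2) : R :=
  if k == 0 then A 0 0 + A 1 2 else A 0 1 + A 1 3.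

Definition disc (A : 'M[R]_(2, 4)) : R :=
  Delta_m A ^+ 2 - 4 * Delta_l A * Delta_r A.

Lemma basis_change_eqs (A B : 'M[R]_(2, 4)) p q r s : basis_change A B p q r s ->
  [/\ [/\ A 0 0 * (p * p) + A 0 1 * (p * q) + A 0 2 * (q * p) + A 0 3 * (q * q)
            = B 0 0 * p + B 1 0 * r
        & A 1 0 * (p * p) + A 1 1 * (p * q) + A 1 2 * (q * p) + A 1 3 * (q * q)
            = B 0 0 * q + B 1 0 * s],
      [/\ A 0 0 * (p * r) + A 0 1 * (p * s) + A 0 2 * (q * r) + A 0 3 * (q * s)
            = B 0 1 * p + B 1 1 * r
        & A 1 0 * (p * r) + A 1 1 * (p * s) + A 1 2 * (q * r) + A 1 3 * (q * s)
            = B 0 1 * q + B 1 1 * s],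
      [/\ A 0 0 * (r * p) + A 0 1 * (r * q) + A 0 2 * (s * p) + A 0 3 * (s * q)
            = B 0 2 * p + B 1 2 * r
        & A 1 0 * (r * p) + A 1 1 * (r * q) + A 1 2 * (s * p) + A 1 3 * (s * q)
            = B 0 2 * q + B 1 2 * s]
    & [/\ A 0 0 * (r * r) + A 0 1 * (r * s) + A 0 2 * (s * r) + A 0 3 * (s * s)
            = B 0 3 * p + B 1 3 * r
        & A 1 0 * (r * r) + A 1 1 * (r * s) + A 1 2 * (s * r) + A 1 3 * (s * s)
            = B 0 3 * q + B 1 3 * s]].
Proof.
have comp (M N : 'cV[R]_2) : M = N -> M 0 0 = N 0 0 /\ M 1 0 = N 1 0 by move=> ->.
case=> _ /comp e11 /comp e12 /comp e21 /comp e22.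
move: e11 e12 e21 e22; rewrite !msc_mulE !vec2E !mxE /=.
by move=> [? ?] [? ?] [? ?] [? ?].
Qed.

(** The trace of an endomorphism does not depend on the basis, so both trace forms transform
    linearly. Cramer's rule extracts the diagonal entries of [B]. *)
Lemma trace_basis_change (A B : 'M[R]_(2, 4)) p q r s :
  basis_change A B p q r s ->
  [/\ trace_l B 0 = p * trace_l A 0 + q * trace_l A 1,
      trace_l B 1 = r * trace_l A 0 + s * trace_l A 1,
      trace_r B 0 = p * trace_r A 0 + q * trace_r A 1
    & trace_r B 1 = r * trace_r A 0 + s * trace_r A 1].
Proof.
move=> bc; have [D0 _ _ _ _] := bc; rewrite /trace_l /trace_r /=.
have [[e11 f11] [e12 f12] [e21 f21] [e22 f22]] := basis_change_eqs bc.
have cramer x y X Y : X = x * p + y * r -> Y = x * q + y * s ->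
    (p * s - q * r) * x = X * s - Y * r /\ (p * s - q * r) * y = Y * p - X * q.
  by move=> -> ->; split; ring.
have [? ?] := cramer _ _ _ _ e11 f11; have [? ?] := cramer _ _ _ _ e12 f12.
have [? ?] := cramer _ _ _ _ e21 f21; have [? ?] := cramer _ _ _ _ e22 f22.
by split; apply: (mulfI D0); rewrite mulrDr; lra.
Qed.

(** * The division property and the discriminant *)

(** The left-hand side is the determinant of [_ . v], a map with [u] in its kernel; the proof
    multiplies by the adjugate. *)
Lemma Delta_form_eq0 (A : 'M[R]_(2, 4)) (u v : 'cV[R]_2) :
  msc_mul A u v = 0 -> u != 0 ->
  Delta_l A * v 0 0 ^+ 2 + Delta_m A * (v 0 0 * v 1 0) + Delta_r A * v 1 0 ^+ 2
    = 0.
Proof.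
move=> uv0 u0; set Q := LHS.
have := congr1 (fun w : 'cV[R]_2 => w 0 0) uv0.
have := congr1 (fun w : 'cV[R]_2 => w 1 0) uv0.
rewrite /= !msc_mulE !mxE => e1 e0.
apply/eqP; apply: contraNT u0 => Q0; apply/eqP.
apply: cV2_eqP; rewrite mxE; apply: (mulfI Q0); rewrite mulr0.
  transitivity ((A 1 2 * v 0 0 + A 1 3 * v 1 0) * 0
              - (A 0 2 * v 0 0 + A 0 3 * v 1 0) * 0); last by ring.
  by rewrite -{1}e0 -e1 /Q /Delta_l /Delta_m /Delta_r /minor; ring.
transitivity ((A 0 0 * v 0 0 + A 0 1 * v 1 0) * 0
            - (A 1 0 * v 0 0 + A 1 1 * v 1 0) * 0); last by ring.
by rewrite -{1}e1 -e0 /Q /Delta_l /Delta_m /Delta_r /minor; ring.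
Qed.

(** A nonnegative discriminant gives a real zero v of the quadratic form, so that right
    multiplication by v is singular; for a negative one, completing the square leaves only v = 0. *)
Lemma division_mscP (A : 'M[R]_(2, 4)) : division (msc_mul A) <-> disc A < 0.
Proof.
split=> [divA | disc0 u v].
  rewrite ltNge; apply/negP=> disc0.
  pose Q (v : 'cV[R]_2) := Delta_l A * v 0 0 ^+ 2
    + Delta_m A * (v 0 0 * v 1 0) + Delta_r A * v 1 0 ^+ 2.
  have [v v0 Qv] : exists2 v, v != 0 & Q v = 0.
    have [l0 | l0] := eqVneq (Delta_l A) 0.
      exists (vec2 1 0); last by rewrite /Q !vec2E l0; ring.
      apply/eqP=> /colP/(_ 0); rewrite !mxE => /eqP.
      by rewrite oner_eq0.
    (* The root from the quadratic formula, cleared of its denominator [2 * Delta_l A]. *)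
    exists (vec2 (Num.sqrt (disc A) - Delta_m A) (2 * Delta_l A)).
      apply/eqP=> /colP/(_ 1); rewrite !mxE => /eqP.
      by rewrite mulf_eq0 (negPf l0) pnatr_eq0.
    have := sqr_sqrtr disc0; rewrite /Q !vec2E /disc.
    move: (Num.sqrt _) => d d2.
    transitivity (Delta_l A * (d ^+ 2 - (Delta_m A ^+ 2
      - 4 * Delta_l A * Delta_r A))); first by ring.
    by rewrite d2 subrr mulr0.
  pose x := A 0 0 * v 0 0 + A 0 1 * v 1 0; pose y := A 0 2 * v 0 0 + A 0 3 * v 1 0.
  pose z := A 1 0 * v 0 0 + A 1 1 * v 1 0; pose w := A 1 2 * v 0 0 + A 1 3 * v 1 0.
  have xwyz : x * w = y * z.
    move: Qv; rewrite /Q /x /y /z /w /Delta_l /Delta_m /Delta_r /minor => Qv.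
    by apply/eqP; rewrite -subr_eq0 -Qv; apply/eqP; ring.
  have ker a b : x * a + y * b = 0 -> z * a + w * b = 0 -> a = 0 /\ b = 0.
    move=> e1 e2; have /divA [e|/eqP] : msc_mul A (vec2 a b) v = 0.
    - by apply: cV2_eqP; rewrite msc_mulE !mxE /=;
        [rewrite -[RHS]e1 /x /y | rewrite -[RHS]e2 /z /w]; ring.
    - by split; [rewrite -(vec2E a b).1 | rewrite -(vec2E a b).2]; rewrite e mxE.
    - by rewrite (negPf v0).
  (* The vectors [(y, - x)] and [(w, - z)] lie in the kernel of the singular matrix with rows
     [(x, y)] and [(z, w)]. A trivial kernel makes the matrix zero, and then [(1, 0)] lies in it. *)
  have [y0 /eqP] : y = 0 /\ - x = 0 by apply: ker; lra.
  rewrite oppr_eq0 => /eqP x0.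
  have [w0 /eqP] : w = 0 /\ - z = 0 by apply: ker; lra.
  rewrite oppr_eq0 => /eqP z0.
  have [/eqP] : 1 = 0 :> R /\ 0 = 0 :> R.
    by apply: ker; rewrite ?x0 ?y0 ?z0 ?w0; lra.
  by rewrite oner_eq0.
split=> [uv0 | [->|->]]; last first.
- by rewrite linear0r.
- by rewrite linear0l.
have [-> | u0] := eqVneq u 0; [by left | right].
have := Delta_form_eq0 uv0 u0; move: disc0; rewrite /disc.
move: (Delta_l A) (Delta_m A) (Delta_r A) (v 0 0) (v 1 0) (cV2_eqP (u := v) (v := 0)).
move=> l m r x y; rewrite !mxE => v0 d0 Q0.
(* Completing the square: with Q the quadratic form, 4 l Q = (2 l x + m y)^2 - disc y^2, and
   symmetrically with r and x. *)
have el : (m ^+ 2 - 4 * l * r) * y ^+ 2 = (2 * l * x + m * y) ^+ 2.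
  by rewrite -[RHS]subr0 -(mulr0 (4 * l)) -Q0; ring.
have er : (m ^+ 2 - 4 * l * r) * x ^+ 2 = (2 * r * y + m * x) ^+ 2.
  by rewrite -[RHS]subr0 -(mulr0 (4 * r)) -Q0; ring.
have sqr_eq0 t e : (m ^+ 2 - 4 * l * r) * t ^+ 2 = e ^+ 2 -> t = 0.
  move=> te; apply/eqP; apply/negPn/negP=> t0.
  have := sqr_ge0 e; rewrite -te leNgt => /negP[].
  by rewrite nmulr_rlt0 // lt_neqAle eq_sym sqrf_eq0 t0 sqr_ge0.
by apply: v0; [exact: sqr_eq0 er | exact: sqr_eq0 el].
Qed.

Lemma disc_msc (a1 a2 a3 a4 b1 b2 b3 b4 : R) :
  disc (msc a1 a2 a3 a4 b1 b2 b3 b4)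
  = ((a1 * b4 - a4 * b1) + (a2 * b3 - a3 * b2)) ^+ 2
    - 4 * (a1 * b3 - a3 * b1) * (a2 * b4 - a4 * b2).
Proof. by rewrite /disc; have [-> -> ->] := DeltaE a1 a2 a3 a4 b1 b2 b3 b4. Qed.

Definition nonneg_beta1 (c : normal_form R) : Prop :=
  match c with
  | A2 _ b _ | A3 _ b _ | A7 _ b | A8 _ b => 0 <= b
  | _ => True
  end.

(** The listed inequalities are the discriminants written out. Only the sign condition is not an
    isomorphism invariant, so it is split off. *)
Lemma admissibleE (c : normal_form R) :
  admissible c <-> disc (msc_of c) < 0 /\ nonneg_beta1 c.
Proof.
case: c => [a1 a2 a4 b1|a1 b1 b2|a1 b1 b2|b1 b2|a1 b1|a1 b1|b1|] /=.
- by split=> [|[]].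
- suff -> : disc (msc_of (A2 a1 b1 b2)) = b1 ^+ 2 + 4 * a1 * (1 - a1) * b2 by tauto.
  by rewrite disc_msc; ring.
- suff -> : disc (msc_of (A3 a1 b1 b2)) = b1 ^+ 2 - 4 * a1 * (1 - a1) * b2 by tauto.
  by rewrite disc_msc; ring.
- suff -> : disc (msc_of (A4 b1 b2)) = (1 - b2) ^+ 2 - 4 * b1 by tauto.
  by rewrite disc_msc; ring.
- suff -> : disc (msc_of (A7 a1 b1)) = b1 ^+ 2 - 4 * a1 ^+ 2 * (1 - a1) by tauto.
  by rewrite disc_msc; ring.
- suff -> : disc (msc_of (A8 a1 b1)) = b1 ^+ 2 + 4 * a1 ^+ 2 * (1 - a1) by tauto.
  by rewrite disc_msc; ring.
- suff -> : disc (msc_of (A9 b1)) = 1 - 4 * b1 by tauto.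
  by rewrite disc_msc; ring.
- split=> // _; split=> //; rewrite disc_msc; lra.
Qed.

Lemma iso_disc_lt0 (A B : 'M[R]_(2, 4)) :
  isomorphic (msc_mul A) (msc_mul B) -> disc A < 0 -> disc B < 0.
Proof. by move=> iAB /division_mscP/(division_iso iAB)/division_mscP. Qed.

Lemma iso_basis_change (A : 'M[R]_(2, 4)) p q r s : p * s - q * r != 0 ->
  exists B, basis_change A B p q r s /\ isomorphic (msc_mul A) (msc_mul B).
Proof.
move=> /(basis_change_exists A)[B bc]; exists B; split=> //.
exact: isomorphic_of_basis_change bc.
Qed.

(** * Reductions when both trace forms vanish on e2 *)

Lemma iso_flip (a e b x y : R) :
  isomorphic (msc_mul (msc a 0 0 e b x y 0))
             (msc_mul (msc a 0 0 e (- b) x y 0)).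
Proof.
apply: (isomorphic_of_basis_change (p := 1) (q := 0) (r := 0) (s := - 1)).
split; first by rewrite !mulr0 subr0 mul1r oppr_eq0 oner_eq0.
all: by apply: cV2_eqP; rewrite msc_mulE !mxE /=; ring.
Qed.

(** Scaling e2 by [t] gives e2 . e2 = e1 or - e1. The zero traces on e2 then clear the rest of the
    top row except its first entry, and the traces on e1 give [l - a] and [m - a]. A negative [b] is
    mended by [iso_flip]. *)
Lemma reduce_a4_neq0 (A : 'M[R]_(2, 4)) l m :
  trace_l A 0 = l -> trace_l A 1 = 0 -> trace_r A 0 = m -> trace_r A 1 = 0 ->
  A 0 3 != 0 ->
  exists e a b, [/\ e = 1 \/ e = -1, 0 <= b & isomorphic (msc_mul A)
    (msc_mul (msc a 0 0 e b (l - a) (m - a) 0))].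
Proof.
move=> l0 l1 m0 m1 a40; pose t := (Num.sqrt `|A 0 3|)^-1.
have t0 : t != 0 by rewrite invr_eq0 sqrtr_eq0 -ltNge normr_gt0.
have te : A 0 3 * t ^+ 2 = Num.sg (A 0 3).
  by rewrite exprVn sqr_sqrtr // {1}[A 0 3]numEsg mulfK // normr_eq0.
(* The new [e1] is proportional to [e2 . e2]. *)
have /(iso_basis_change A)[B [bc iAB]] : 1 * t - (A 1 3 / A 0 3) * 0 != 0.
  by rewrite mulr0 subr0 mul1r.
have [tl0 tl1 tr0 tr1] := trace_basis_change bc.
have [[e11 f11] [e12 f12] [e21 f21] [e22 f22]] := basis_change_eqs bc.
have B03 : B 0 3 = Num.sg (A 0 3) by rewrite -te; lra.
have B13 : B 1 3 = 0.
  apply: (mulIf t0); rewrite mul0r.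
  transitivity (A 1 3 * (t * t) - B 0 3 * (A 1 3 / A 0 3)); first by lra.
  by rewrite B03 -te; field.
have [B02 B01] : B 0 2 = 0 /\ B 0 1 = 0.
  by move: tl1 tr1; rewrite /trace_l /trace_r /= in l1 m1 *; split; nra.
have [B11 B12] : B 1 1 = l - B 0 0 /\ B 1 2 = m - B 0 0.
  by move: tl0 tr0; rewrite l0 l1 m0 m1 /trace_l /trace_r /=; split; lra.
have sg1 : Num.sg (A 0 3) = 1 \/ Num.sg (A 0 3) = -1.
  by case: sgrP a40 => [|_|_] // _; [left | right].
rewrite [B]mscE B03 B13 B02 B01 B11 B12 in iAB.
have [b0 | b0] := leP 0 (B 1 0).
  by exists (Num.sg (A 0 3)), (B 0 0), (B 1 0).
exists (Num.sg (A 0 3)), (B 0 0), (- B 1 0); split=> //; first by lra.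
exact: isomorphic_trans iAB (iso_flip _ _ _ _ _).
Qed.

(** Here e2 . e2 is a multiple of e2, nonzero because otherwise the discriminant would be a square;
    scaling turns it into - e2. *)
Lemma reduce_a4_eq0 (A : 'M[R]_(2, 4)) l m :
  trace_l A 0 = l -> trace_l A 1 = 0 -> trace_r A 0 = m -> trace_r A 1 = 0 ->
  disc A < 0 -> A 0 3 = 0 ->
  exists b, isomorphic (msc_mul A) (msc_mul (msc 0 1 1 0 b l m (-1))).
Proof.
move=> l0 l1 m0 m1 dA a40.
have A13 : A 1 3 = - A 0 1 by move: m1; rewrite /trace_r /=; lra.
have A02 : A 0 2 = A 0 1 by move: l1; rewrite /trace_l /=; lra.
have a20 : A 0 1 != 0.
  apply: contraTneq dA => a20; rewrite -leNgt /disc /Delta_r /minor.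
  by rewrite a40 a20 !mul0r subr0 mulr0 subr0 sqr_ge0.
(* The shift [- A 0 0 / (2 * A 0 1)] of e1 along e2 cancels the e1-component of e1 . e1. *)
have /(iso_basis_change A)[B [bc iAB]] :
    1 * (A 0 1)^-1 - (- A 0 0 / (2 * A 0 1)) * 0 != 0.
  by rewrite mulr0 subr0 mul1r invr_eq0.
have [tl0 tl1 tr0 tr1] := trace_basis_change bc.
have [[e11 f11] [e12 f12] [e21 f21] [e22 f22]] := basis_change_eqs bc.
rewrite A13 A02 a40 in e11 f11 e12 f12 e21 f21 e22 f22.
have B03 : B 0 3 = 0 by lra.
have B13 : B 1 3 = -1.
  apply: (mulIf (x := (A 0 1)^-1)); first by rewrite invr_eq0.
  rewrite B03 in f22; transitivity (- A 0 1 * ((A 0 1)^-1 * (A 0 1)^-1)).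
    by lra.
  by field.
have B00 : B 0 0 = 0.
  transitivity (A 0 0 + 2 * A 0 1 * (- A 0 0 / (2 * A 0 1))); first by lra.
  by field.
rewrite l0 l1 in tl0 tl1; rewrite m0 m1 in tr0 tr1.
rewrite /trace_l /trace_r /= in tl0 tl1 tr0 tr1.
have [B02 B01] : B 0 2 = 1 /\ B 0 1 = 1 by split; lra.
have [B11 B12] : B 1 1 = l /\ B 1 2 = m by split; lra.
by exists (B 1 0); rewrite [B]mscE B00 B03 B13 B02 B01 B11 B12 in iAB.
Qed.

(** * Real roots of cubics and the traceless case *)

Lemma monic_cubic_root (b c d : R) : exists y, y ^+ 3 + b * y ^+ 2 + c * y + d = 0.
Proof.
pose f : {poly R} := 'X^3 + b *: 'X^2 + c *: 'X + d%:P.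
(* At [M] and [- M] the cubic term dominates the others, so the polynomial changes sign on this
   interval. *)
pose M := 1 + `|b| + `|c| + `|d|.
have fE y : f.[y] = y ^+ 3 + b * y ^+ 2 + c * y + d by rewrite /f !hornerE.
have [b0 c0 d0] : [/\ 0 <= `|b|, 0 <= `|c| & 0 <= `|d|] by rewrite !normr_ge0.
have M1 : 1 <= M by rewrite /M; lra.
have abs (x : R) : - `|x| <= x <= `|x| by rewrite -ler_norml.
have /andP[b1 b2] := abs b; have /andP[c1 c2] := abs c; have /andP[d1 d2] := abs d.
have M2 : M <= M ^+ 2 by nra.
have bnd : `|b| * M ^+ 2 + `|c| * M + `|d| <= M ^+ 3.
  have -> : M ^+ 3 = M ^+ 2 + `|b| * M ^+ 2 + `|c| * M ^+ 2 + `|d| * M ^+ 2.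
    by rewrite /M; ring.
  have : `|c| * M <= `|c| * M ^+ 2 by apply: ler_wpM2l.
  have : `|d| * 1 <= `|d| * M ^+ 2 by apply: ler_wpM2l => //; lra.
  by lra.
have M0 : 0 <= M by lra.
have [bM1 bM2] : - (`|b| * M ^+ 2) <= b * M ^+ 2 /\ b * M ^+ 2 <= `|b| * M ^+ 2.
  by split; rewrite -?mulNr ler_wpM2r // sqr_ge0.
have [cM1 cM2] : - (`|c| * M) <= c * M /\ c * M <= `|c| * M.
  by split; rewrite -?mulNr ler_wpM2r.
have [||y _ /rootP fy] := @poly_ivt _ f (- M) M; first by lra.
  by rewrite !fE; apply/andP; split; lra.
by exists y; rewrite -fE.
Qed.

Lemma cubic_root (a b c d : R) : a != 0 ->
  exists y, a * y ^+ 3 + b * y ^+ 2 + c * y + d = 0.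
Proof.
move=> a0; have [y ey] := monic_cubic_root (b / a) (c / a) (d / a); exists y.
by rewrite -(mulr0 a) -ey; field.
Qed.

(** Zero traces make the multiplication commutative, with det (u, u . u) a binary cubic form. A real
    zero of this form, taken as e2, has its square proportional to itself. *)
Lemma traceless_a4_eq0 (A : 'M[R]_(2, 4)) :
  (forall k, trace_l A k = 0) -> (forall k, trace_r A k = 0) ->
  exists B, [/\ forall k, trace_l B k = 0, forall k, trace_r B k = 0, B 0 3 = 0
    & isomorphic (msc_mul A) (msc_mul B)].
Proof.
move=> l0 m0; have [a40 | a40] := eqVneq (A 0 3) 0.
  exists A; split=> //; exact: isomorphic_refl.
(* [y] is chosen so that [(1, y) . (1, y)] is proportional to [(1, y)]. *)
have [y ey] : exists y, A 0 3 * y ^+ 3 + 3 * A 0 1 * y ^+ 2 + 3 * A 0 0 * y - A 1 0 = 0.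
  have [z ez] := cubic_root (3 * A 0 1) (3 * A 0 0) (- A 1 0) a40.
  by exists z.
have /(iso_basis_change A)[B [bc iAB]] : 0 * y - 1 * 1 != 0 :> R.
  by rewrite mul0r mul1r sub0r oppr_eq0 oner_eq0.
have [tl0 tl1 tr0 tr1] := trace_basis_change bc.
have [_ _ _ [e22 f22]] := basis_change_eqs bc.
exists B; split=> //.
- by apply: ord2_cases; rewrite ?tl0 ?tl1 !l0 !mulr0 addr0.
- by apply: ord2_cases; rewrite ?tr0 ?tr1 !m0 !mulr0 addr0.
have := (l0 0, l0 1, m0 0, m0 1); rewrite /trace_l /trace_r /= => -[[[h1 h2] h3] h4].
have A11 : A 1 1 = - A 0 0 by lra.
have A12 : A 1 2 = - A 0 0 by lra.
have A13 : A 1 3 = - A 0 1 by lra.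
have A02 : A 0 2 = A 0 1 by lra.
rewrite A11 A12 A13 A02 in e22 f22.
have e13 : B 1 3 = A 0 0 + 2 * A 0 1 * y + A 0 3 * y ^+ 2 by lra.
by rewrite e13 in f22; lra.
Qed.

Lemma iso_A12 (b : R) : 0 < b ->
  isomorphic (msc_mul (msc 0 1 1 0 b 0 0 (-1))) (msc_mul (msc_of A12)).
Proof.
move=> b0; pose t := (Num.sqrt b)^-1.
have t0 : t != 0 by rewrite invr_eq0 sqrtr_eq0 -ltNge.
have tb : b * t ^+ 2 = 1 by rewrite exprVn sqr_sqrtr ?divff ?gt_eqF // ltW.
apply: (isomorphic_of_basis_change (p := t) (q := 0) (r := 0) (s := 1)).
split; first by rewrite mulr1 mulr0 subr0.
all: by apply: cV2_eqP; rewrite msc_mulE !mxE /=; lra.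
Qed.

(** * Existence of a normal form *)

Lemma normal_form_indep (A : 'M[R]_(2, 4)) :
  trace_r A 0 * trace_l A 1 - trace_r A 1 * trace_l A 0 != 0 ->
  exists a1 a2 a4 b1, isomorphic (msc_mul A) (msc_mul (msc_of (A1 a1 a2 a4 b1))).
Proof.
set x1 := trace_l A 0; set x2 := trace_l A 1.
set y1 := trace_r A 0; set y2 := trace_r A 1; set w := _ - _ => w0.
(* The basis dual to the right and left trace forms, in this order. *)
have /(iso_basis_change A)[B [bc iAB]] :
    x2 / w * (y1 / w) - (- x1 / w) * (- y2 / w) != 0.
  have -> : x2 / w * (y1 / w) - (- x1 / w) * (- y2 / w) = w^-1.
    by rewrite /w; field.
  by rewrite invr_eq0.
have [tl0 tl1 tr0 tr1] := trace_basis_change bc.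
have {}tl0 : trace_l B 0 = 0 by rewrite tl0 -/x1 -/x2; ring.
have {}tl1 : trace_l B 1 = 1 by rewrite tl1 -/x1 -/x2 /w; field.
have {}tr0 : trace_r B 0 = 1 by rewrite tr0 -/y1 -/y2 /w; field.
have {}tr1 : trace_r B 1 = 0 by rewrite tr1 -/y1 -/y2; ring.
rewrite /trace_l /trace_r /= in tl0 tl1 tr0 tr1.
exists (B 0 0), (B 0 1), (B 0 3), (B 1 0); rewrite [B]mscE in iAB.
by congr (isomorphic _ (msc_mul (msc _ _ _ _ _ _ _ _))): iAB; lra.
Qed.

Lemma normal_form_dep (A : 'M[R]_(2, 4)) l m :
  trace_l A 0 = l -> trace_l A 1 = 0 -> trace_r A 0 = m -> trace_r A 1 = 0 ->
  m = 1 \/ m = 0 /\ l = 1 -> disc A < 0 ->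
  exists c, nonneg_beta1 c /\ isomorphic (msc_mul A) (msc_mul (msc_of c)).
Proof.
move=> l0 l1 m0 m1 lm dA; have [a40 | a40] := eqVneq (A 0 3) 0.
  have [b iA] := reduce_a4_eq0 l0 l1 m0 m1 dA a40.
  case: lm => [em | [em el]]; rewrite em ?el in iA.
    by exists (A4 b l).
  by exists (A9 b).
have [e [a [b [e1 b0 iA]]]] := reduce_a4_neq0 l0 l1 m0 m1 a40.
case: lm e1 => [em | [em el]] [e1 | e1]; rewrite em ?el e1 ?sub0r in iA.
- by exists (A2 a b (l - a)).
- by exists (A3 a b (l - a)).
- by exists (A7 a b).
- by exists (A8 a b).
Qed.

Lemma normal_form_exists (A : 'M[R]_(2, 4)) : disc A < 0 ->
  exists c, nonneg_beta1 c /\ isomorphic (msc_mul A) (msc_mul (msc_of c)).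
Proof.
move=> dA.
set x1 := trace_l A 0; set x2 := trace_l A 1.
set y1 := trace_r A 0; set y2 := trace_r A 1.
have [w0 | w0] := eqVneq (y1 * x2 - y2 * x1) 0; last first.
  have [a1 [a2 [a4 [b1 iA]]]] := normal_form_indep w0.
  by exists (A1 a1 a2 a4 b1).
have sqr2 (x y : R) : x ^+ 2 + y ^+ 2 = 0 -> x = 0 /\ y = 0.
  by move=> e; split; apply/eqP; rewrite -sqrf_eq0; apply/eqP; nra.
have [/sqr2[y10 y20] | N0] := eqVneq (y1 ^+ 2 + y2 ^+ 2) 0; last first.
  (* With y the right trace form, e1 = y / |y|^2 has right trace 1, and e2 = (- y2, y1) spans the
     kernel of y, hence is also killed by the dependent left form. *)
  have /(iso_basis_change A)[B [bc iAB]] :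
      y1 / (y1 ^+ 2 + y2 ^+ 2) * y1 - y2 / (y1 ^+ 2 + y2 ^+ 2) * (- y2) != 0.
    have -> : y1 / (y1 ^+ 2 + y2 ^+ 2) * y1 - y2 / (y1 ^+ 2 + y2 ^+ 2) * (- y2) = 1.
      by field.
    exact: oner_neq0.
  have [_ tl1 tr0 tr1] := trace_basis_change bc.
  have [||||||c [b0 iB]] := @normal_form_dep B (trace_l B 0) 1 => //.
  - by rewrite tl1 -/x1 -/x2; lra.
  - by rewrite tr0 -/y1 -/y2; field.
  - by rewrite tr1 -/y1 -/y2; ring.
  - by left.
  - exact: iso_disc_lt0 iAB dA.
  - by exists c; split=> //; exact: isomorphic_trans iAB iB.
have [/sqr2[x10 x20] | N0] := eqVneq (x1 ^+ 2 + x2 ^+ 2) 0; last first.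
  have /(iso_basis_change A)[B [bc iAB]] :
      x1 / (x1 ^+ 2 + x2 ^+ 2) * x1 - x2 / (x1 ^+ 2 + x2 ^+ 2) * (- x2) != 0.
    have -> : x1 / (x1 ^+ 2 + x2 ^+ 2) * x1 - x2 / (x1 ^+ 2 + x2 ^+ 2) * (- x2) = 1.
      by field.
    exact: oner_neq0.
  have [tl0 tl1 tr0 tr1] := trace_basis_change bc.
  have [||||||c [b0 iB]] := @normal_form_dep B 1 0 => //.
  - by rewrite tl0 -/x1 -/x2; field.
  - by rewrite tl1 -/x1 -/x2; ring.
  - by rewrite tr0 -/y1 -/y2 y10 y20; ring.
  - by rewrite tr1 -/y1 -/y2 y10 y20; ring.
  - by right.
  - exact: iso_disc_lt0 iAB dA.
  - by exists c; split=> //; exact: isomorphic_trans iAB iB.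
have [||B [lB mB B03 iAB]] := @traceless_a4_eq0 A; try exact: ord2_cases.
have dB := iso_disc_lt0 iAB dA.
have [b iB] := reduce_a4_eq0 (lB 0) (lB 1) (mB 0) (mB 1) dB B03.
(* The discriminant is now - 4 b. *)
have b0 : 0 < b by have := iso_disc_lt0 iB dB; rewrite disc_msc; lra.
exists A12; split=> //; apply: (isomorphic_trans iAB).
exact: isomorphic_trans iB (iso_A12 b0).
Qed.

(** * Uniqueness of the normal form *)

Lemma basis_change_msc_of_inj (c c' : normal_form R) p q r s :
  nonneg_beta1 c -> nonneg_beta1 c' ->
  basis_change (msc_of c) (msc_of c') p q r s -> c = c'.
Proof.
move=> b0 b0' bc; have [D0 _ _ _ _] := bc.
(* In the families with beta1 >= 0, the basis change may send e2 to - e2; nonnegativity still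
   identifies the two values of beta1. *)
have sgn t (x y : R) : t ^+ 2 = 1 -> x = y * t -> 0 <= x -> 0 <= y -> x = y.
  move=> t1 xy x0 y0; apply/eqP; rewrite -(eqrXn2 (n := 2)) //.
  by rewrite xy exprMn t1 mulr1.
have := trace_basis_change bc; have := basis_change_eqs bc.
case: c c' b0 b0' {bc} => [a1 a2 a4 b1|a1 b1 b2|a1 b1 b2|b1 b2|a1 b1|a1 b1|b1|]
  [a1' a2' a4' b1'|a1' b1' b2'|a1' b1' b2'|b1' b2'|a1' b1'|a1' b1'|b1'|] /= b0 b0';
  rewrite /trace_l /trace_r /= !mxE /=
    => -[[e11 f11] [e12 f12] [e21 f21] [e22 f22]] [tl0 tl1 tr0 tr1].
(* For members of different families the equations are inconsistent with a nonzero determinant; the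
   eight pairs within one family remain. *)
all: try (by exfalso; move/eqP: D0; apply; nra).
- have [[q0 s1] [p1 r0]] : (q = 0 /\ s = 1) /\ p = 1 /\ r = 0 by lra.
  by subst; congr A1; lra.
- have [p1 r0] : p = 1 /\ r = 0 by lra.
  (* In both tables e2 . e2 = e1, so the multiple e2 of the old e2 forces the new e1 to have no
     e2-component. *)
  subst; have q0 : q = 0 by lra.
  by subst; congr A2; [lra | apply: (sgn s); lra | lra].
- have [p1 r0] : p = 1 /\ r = 0 by lra.
  subst; have q0 : q = 0 by lra.
  by subst; congr A3; [lra | apply: (sgn s); lra | lra].
- have [p1 r0] : p = 1 /\ r = 0 by lra.
  (* Now e1 . e1 has no e1-component in either table, which gives [q = 0], and e2 . e2 = - e2 in
     both gives [s = 1]. *)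
  subst; have q0 : q = 0 by lra.
  have s1 : s = 1.
    by move: D0; rewrite mul1r mulr0 subr0 => s0; apply: (mulIf s0); lra.
  by subst; congr A4; lra.
- have [p1 r0] : p = 1 /\ r = 0 by lra.
  subst; have q0 : q = 0 by lra.
  by subst; congr A7; [lra | apply: (sgn s); lra].
- have [p1 r0] : p = 1 /\ r = 0 by lra.
  subst; have q0 : q = 0 by lra.
  by subst; congr A8; [lra | apply: (sgn s); lra].
- have [p1 r0] : p = 1 /\ r = 0 by lra.
  subst; have q0 : q = 0 by lra.
  have s1 : s = 1.
    by move: D0; rewrite mul1r mulr0 subr0 => s0; apply: (mulIf s0); lra.
  by subst; congr A9; lra.
- by [].
Qed.

(** * From abstract algebras to structure constants, and the classification *)

Lemma isomorphic_msc (V : vectType R) (mul : {bilinear V -> V -> V}) :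
  \dim {:V} = 2%N -> exists A, isomorphic mul (msc_mul A).
Proof.
move=> dimV; have [e e_basis] : exists e : 2.-tuple V, basis_of {:V} e.
  by exists (tcast dimV (vbasis {:V})); rewrite val_tcast vbasisP.
pose f u : 'cV[R]_2 := \col_i coord e i u.
have lin_f : linear f by move=> a u v; apply/colP=> i; rewrite !mxE linearP.
pose fL : {linear V -> 'cV[R]_2} :=
  HB.pack f (GRing.isLinear.Build R _ _ *:%R f lin_f).
have fK u : u = f u 0 0 *: e`_0 + f u 1 0 *: e`_1.
  rewrite {1}(coord_basis e_basis (memvf u)) !big_ord_recl big_ord0 addr0 !mxE.
  by congr (_ + coord e _ u *: _); apply: val_inj.
have f0 : f 0 = 0 by apply/colP=> i; rewrite !mxE linear0.
have fe x y : f (x *: e`_0 + y *: e`_1) = vec2 x y.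
  (* [lin_f] applies to sums of the shape [a *: u + v], hence the added zero. *)
  rewrite lin_f -[y *: _]addr0 lin_f.
  rewrite f0.
  have fr := basis_free e_basis.
  have c0 i : coord e i e`_0 = (0 == i)%:R := coord_free 0 i fr.
  have c1 i : coord e i e`_1 = (1 == i)%:R := coord_free 1 i fr.
  by apply: cV2_eqP; rewrite !mxE c0 c1 /=; ring.
(* Column [j] belongs to the pair (j / 2, j mod 2), inverting the numbering 2 i + j of pairs. *)
exists (\matrix_(k, j) f (mul e`_(j %/ 2) e`_(j %% 2)) k 0); exists fL; split=> /=.
  exists (fun w : 'cV[R]_2 => w 0 0 *: e`_0 + w 1 0 *: e`_1) => [u|w].
    by rewrite -fK.
  by rewrite /= fe -vec2_eta.
have f4 a b c d (w x y z : V) : f (a *: w + b *: x + c *: y + d *: z)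
    = a *: f w + b *: f x + c *: f y + d *: f z.
  by rewrite -!addrA !lin_f -[d *: z]addr0 lin_f f0 addr0.
move=> u v; rewrite {1}[u]fK {1}[v]fK bilinear_expand f4.
by apply/colP=> k; rewrite msc_mulE !mxE /=; ring.
Qed.

End Classification.

Theorem theorem2p9 (R : realType) :
  (forall c : normal_form R,
     admissible c -> division (msc_mul (msc_of c))) /\
  (forall (V : vectType R) (mul : {bilinear V -> V -> V}),
     \dim {:V} = 2%N -> nontrivial mul -> division mul ->
     exists! c : normal_form R,
       admissible c /\ isomorphic mul (msc_mul (msc_of c))).
Proof.
split=> [c /admissibleE[dc _]|V mul dimV _ divV]; first exact/division_mscP.
have [A iA] := isomorphic_msc mul dimV.
have dA : disc A < 0 by apply/division_mscP/(division_iso iA).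
have [c [c0 ic]] := normal_form_exists dA.
exists c; split=> [|c' [/admissibleE[_ c'0] ic']].
  split; last exact: isomorphic_trans iA ic.
  by apply/admissibleE; split=> //; exact: iso_disc_lt0 ic dA.
have icc' := isomorphic_trans (isomorphic_trans (isomorphic_sym ic)
  (isomorphic_sym iA)) ic'.
have [p [q [r [s bc]]]] := basis_change_of_isomorphic icc'.
exact: basis_change_msc_of_inj c0 c'0 bc.
Qed.
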